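(* Let $Z$ be a cycle offset zonotope of a PESP instance $(G,T,\ell,u,w)$ on the digraph $G$ (with respect to an integral cycle basis of $G$). Fix any fine zonotopal tiling of $Z$. Then there is a one-to-one correspondence between spanning subgraphs of $G$ with $|A(G)|-k$ arcs and the $k$-dimensional cells of the tiling such that the arc set $S$ of a spanning subgraph maps to a translate of $Z(\Gamma'_S)$.
   Context: A PESP instance $(G,T,\ell,u,w)$ consists of a finite directed graph $G$ with vertex set $V(G)$ and arc set $A(G)$, a positive integer $T$, and $\ell,u,w\in\mathbb{R}^{A(G)}$. Standing assumptions: $G$ is simple, 2-connected (as an undirected graph), has no pair of antiparallel arcs, and $0\le\ell_a<T$, $0<u_a-\ell_a<T$ for all arcs $a$. A spanning subgraph is a subgraph of $G$ that contains a spanning tree of $G$ (orientations ignored). $B\in\{-1,0,1\}^{V(G)\times A(G)}$ is the incidence matrix of $G$. An oriented cycle is a vector $\gamma\in\{-1,0,1\}^{A(G)}$ with $B\gamma=0$, i.e. a circuit in $G$ whose arcs can be traversed in forward or backward direction. The cycle space is the abelian group generated by the oriented cycles; its rank is $\mu=|A(G)|-|V(G)|+1$. An integral cycle basis is a tuple $\mathscr{B}=(\gamma_1,\dots,\gamma_\mu)$ of oriented cycles generating the cycle space as a $\mathbb{Z}$-module; its cycle matrix is $\Gamma=(\gamma_1,\dots,\gamma_\mu)^\top\in\mathbb{Z}^{\mathscr{B}\times A(G)}$. For a matrix $M$ and a vector $b$, let $Z(M,b)=\{Mx\mid\mathbf{0}\le x\le\mathbf{1}\}+b$ and $Z(M)=Z(M,\mathbf{0})$.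 The matrix $\Gamma'$ is obtained from $\Gamma$ by multiplying the column of each arc $a$ by $(u_a-\ell_a)/T$. The cycle offset zonotope is $Z=\{\Gamma x/T\mid x\in\mathbb{R}^{A(G)},\ \ell\le x\le u\}=Z(\Gamma',\Gamma\ell/T)$; it has dimension $\mu$. For $S\subseteq A(G)$, $\Gamma'_S$ is the submatrix of $\Gamma'$ obtained by deleting the columns indexed by $S$. A zonotopal tiling of $Z$ is a polyhedral subdivision of $Z$ such that the cells are translates of zonotopes $Z(\Gamma'_S)$, $S\subseteq A(G)$. The maximal cells are called tiles. The tiling is fine if all tiles are parallelotopes, i.e. the generators of each tile are linearly independent.
   Formalization: For k below the dimension of Z the correspondence is with classes of parallel k-cells, not single cells (for tiles it is with the cells); tilings are those whose cells are labelled by faces of the cube, since with parallel generators an unlabelled tiling can have too few tiles. *)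

(* Defs.v *)
(* MathComp / MathComp-Analysis. *)
From mathcomp Require Import all_boot all_order all_algebra.
From mathcomp Require Import boolp classical_sets functions cardinality reals.

Set Implicit Arguments.
Unset Strict Implicit.
Unset Printing Implicit Defensive.

Import Order.TTheory GRing.Theory Num.Theory.
Local Open Scope classical_set_scope.
Local Open Scope ring_scope.

(* Vertices are numbered by 'I_n and arcs by 'I_m, so that arc vectors are
   columns of height m. *)
Record digraph (n m : nat) := Digraph {
  src : 'I_m -> 'I_n;
  tgt : 'I_m -> 'I_n }.

Record pesp (R : realType) (n m : nat) := Pesp {
  graph : digraph n m;
  period : nat;
  lower : 'cV[R]_m;
  upper : 'cV[R]_m;
  weight : 'cV[R]_m }.

Section Graphs.
Variables (n m : nat) (G : digraph n m).

Definition simple_digraph : Prop :=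
  (forall a, src G a <> tgt G a) /\
  (forall a b, src G a = src G b -> tgt G a = tgt G b -> a = b).

Definition no_antiparallel : Prop :=
  forall a b, ~ (src G a = tgt G b /\ tgt G a = src G b).

Definition linked (S : {set 'I_m}) (W : {set 'I_n}) : rel 'I_n :=
  fun x y => [&& x \in W, y \in W &
    [exists a in S, ((src G a == x) && (tgt G a == y)) ||
                    ((src G a == y) && (tgt G a == x))]].

(* The undirected graph with vertex set W and those arcs of S that have both
   ends in W is connected. *)
Definition connected_on (S : {set 'I_m}) (W : {set 'I_n}) : Prop :=
  forall x y, x \in W -> y \in W -> connect (linked S W) x y.

Definition two_connected : Prop :=
  [/\ (2 < n)%N,
      connected_on [set: 'I_m]%SET [set: 'I_n]%SET
    & forall v, connected_on [set: 'I_m]%SET [set~ v]%SET].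

Definition incidence : 'M[int]_(n, m) :=
  \matrix_(v, a) ((v == tgt G a)%:R - (v == src G a)%:R).

Definition oriented_cycle (g : 'cV[int]_m) : Prop :=
  (forall a, g a 0 = -1 \/ g a 0 = 0 \/ g a 0 = 1) /\ incidence *m g = 0.

Definition cycle_space : set 'cV[int]_m :=
  [set x | forall H : set 'cV[int]_m,
     (forall g, oriented_cycle g -> H g) -> H 0 ->
     (forall y z, H y -> H z -> H (y - z)) -> H x].

(* No truncation occurs for a connected graph, where n <= m + 1. *)
Definition cyclomatic : nat := (m.+1 - n)%N.

Definition integral_cycle_basis (gam : 'I_cyclomatic -> 'cV[int]_m) : Prop :=
  (forall i, oriented_cycle (gam i)) /\
  (forall x, cycle_space x ->
     exists z : 'I_cyclomatic -> int, x = \sum_i z i *: gam i).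

(* The zero vector also satisfies oriented_cycle, hence g <> 0. *)
Definition acyclic (F : {set 'I_m}) : Prop :=
  ~ exists g, [/\ oriented_cycle g, g <> 0 & forall a, g a 0 <> 0 -> a \in F].

Definition spanning_tree (F : {set 'I_m}) : Prop :=
  connected_on F [set: 'I_n]%SET /\ acyclic F.

(* The vertex set of a spanning subgraph is that of G, so the subgraph is
   determined by its arc set. *)
Definition spanning_subgraph (S : {set 'I_m}) : Prop :=
  exists F : {set 'I_m}, F \subset S /\ spanning_tree F.

End Graphs.

Definition pesp_instance (R : realType) n m (I : pesp R n m) : Prop :=
  [/\ simple_digraph (graph I), no_antiparallel (graph I),
      two_connected (graph I), (0 < period I)%N
    & forall a,
        (0 <= lower I a 0 < (period I)%:R) /\
        (0 < upper I a 0 - lower I a 0 < (period I)%:R)].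

Section Polyhedra.
Variables (R : realType) (d : nat).
Implicit Types (C D F Q : set 'cV[R]_d) (K : set (set 'cV[R]_d)).

Definition zonotope p (M : 'M[R]_(d, p)) (b : 'cV[R]_d) : set 'cV[R]_d :=
  [set M *m x + b | x in [set x : 'cV[R]_p | forall j, 0 <= x j 0 <= 1]].

Definition is_translate C D : Prop :=
  exists t : 'cV[R]_d, C = [set x + t | x in D].

(* The affine hull of C is x0 plus the k-dimensional row space of M. *)
Definition has_dim C (k : nat) : Prop :=
  exists (x0 : 'cV[R]_d) (M : 'M[R]_(k, d)),
    [/\ C x0, row_free M, forall i, C (x0 + (row i M)^T)
      & forall x, C x -> ((x - x0)^T <= M)%MS].

Definition polytope C : Prop :=
  exists (p : nat) (M : 'M[R]_(d, p)),
    C = [set M *m x | x in [set x : 'cV[R]_p |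
                              (forall j, 0 <= x j 0) /\ \sum_j x j 0 = 1]].

(* The nonempty faces of a polytope: maximizers of a linear form. *)
Definition is_face F C : Prop :=
  exists c : 'rV[R]_d,
    F = [set x | C x /\ forall y, C y -> (c *m y) 0 0 <= (c *m x) 0 0].

(* The empty cell is left implicit. *)
Definition polyhedral_subdivision Q K : Prop :=
  [/\ finite_set K,
      forall C, K C -> polytope C /\ C !=set0,
      \bigcup_(C in K) C = Q,
      forall C F, K C -> is_face F C -> K F
    & forall C D, K C -> K D ->
        C `&` D = set0 \/ (is_face (C `&` D) C /\ is_face (C `&` D) D)].

End Polyhedra.

(* A face of the cube [0,1]^A: coordinate a is free if the label of a is None,
   and fixed to 0 or 1 if it is Some false or Some true. *)
Definition cube_label (m : nat) := {ffun 'I_m -> option bool}.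

Definition cube_face (R : realType) m (s : cube_label m) : set 'cV[R]_m :=
  [set x | forall a, match s a with
                     | None => 0 <= x a 0 <= 1
                     | Some e => x a 0 = e%:R
                     end].

Definition fixed_arcs m (s : cube_label m) : {set 'I_m} :=
  [set a | s a != None]%SET.

Section Zonotope.
Variables (R : realType) (n m : nat) (I : pesp R n m).
Let mu := cyclomatic n m.
Variable gam : 'I_mu -> 'cV[int]_m.

Definition cycle_matrix : 'M[R]_(mu, m) := \matrix_(i, a) (gam i a 0)%:~R.

Definition scaled_cycle_matrix : 'M[R]_(mu, m) :=
  \matrix_(i, a) (cycle_matrix i a *
                  ((upper I a 0 - lower I a 0) / (period I)%:R)).

(* The columns indexed by S are deleted. *)
Definition scaled_cycle_submatrix (S : {set 'I_m}) :
    'M[R]_(mu, #|(~: S)%SET|) :=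
  colsub (fun j : 'I_#|(~: S)%SET| => enum_val j) scaled_cycle_matrix.

Definition cycle_offset : 'cV[R]_mu :=
  (period I)%:R^-1 *: (cycle_matrix *m lower I).

Definition cycle_offset_zonotope : set 'cV[R]_mu :=
  [set (period I)%:R^-1 *: (cycle_matrix *m x) |
    x in [set x : 'cV[R]_m | forall a, lower I a 0 <= x a 0 <= upper I a 0]].

Definition cell_offset (s : cube_label m) : 'cV[R]_mu :=
  cycle_offset + \sum_(a | s a == Some true) col a scaled_cycle_matrix.

(* The image of cube_face s under x |-> scaled_cycle_matrix *m x + cycle_offset,
   which maps the cube onto the cycle offset zonotope. *)
Definition cell (s : cube_label m) : set 'cV[R]_mu :=
  zonotope (scaled_cycle_submatrix (fixed_arcs s)) (cell_offset s).

(* Zonotopal tilings carry the usual labels by faces of the cube (the strong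
   tilings of Richter-Gebert and Ziegler, i.e. the subdivisions induced by the
   projection of the cube, in the sense of Billera and Sturmfels).  Unlabelled
   cells would not do when generators are parallel, which is what arcs in series
   produce: the segment with generators 1, 1, 2 is tiled by two segments of
   length 2, both of them translates of the zonotope of the third generator. *)
Definition zonotopal_tiling (X : {set cube_label m}) : Prop :=
  [/\ polyhedral_subdivision cycle_offset_zonotope
        [set cell s | s in [set` X]],
      {in X &, injective cell}
    & {in X &, forall s t, cell s `<=` cell t ->
        @cube_face R m s = @cube_face R m t `&`
          [set x | cell s (scaled_cycle_matrix *m x + cycle_offset)]}].

Definition is_tile (X : {set cube_label m}) (s : cube_label m) : Prop :=
  s \in X /\ {in X, forall t, cell s `<=` cell t -> cell t = cell s}.

Definition fine_zonotopal_tiling (X : {set cube_label m}) : Prop :=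
  zonotopal_tiling X /\
  forall s, is_tile X s ->
    row_free (scaled_cycle_submatrix (fixed_arcs s))^T.

Definition cells_of_dim (X : {set cube_label m}) (k : nat) :
    {set cube_label m} :=
  [set s in X | `[< has_dim (cell s) k >]]%SET.

(* The k-dimensional cells up to translation: two cells are identified if they
   have the same generators, i.e. are images of parallel faces of the cube. *)
Definition parallel_classes (X : {set cube_label m}) (k : nat) :
    {set {set cube_label m}} :=
  equivalence_partition [rel s t | fixed_arcs s == fixed_arcs t]
    (cells_of_dim X k).

End Zonotope.

Definition spanning_subgraphs n m (G : digraph n m) (p : nat) :
    set {set 'I_m} :=
  [set S | spanning_subgraph G S /\ #|S| = p].

(* Main.v *)
(* Let X be the set of labels, M the scaled cycle matrix and U the union of the
   cube faces in X.  The strong tiling property makes x |-> M x + offset a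
   bijection from U onto the zonotope.  Let the columns of M indexed by J be
   independent and let y lie in the open cube (0,1)^J.  Then, modulo the span of
   these columns, every point of the zonotope has exactly one preimage x in U
   with x_J = y.  This goes by induction on J: when b is added, the coordinate
   x_b of the section varies continuously along each line in direction M_b, with
   slope 0 or 1; at the lower end of the line it is 0, since otherwise one could
   move on inside the cube, and likewise it is 1 at the upper end, so it takes
   each value in (0,1) exactly once.  Hence some face in X has its free arcs
   containing J, and then a subface has free arcs exactly J; if J is a basis,
   this face is unique.  Finally the columns outside S are independent if and
   only if S is connected: a dependency is orthogonal to the fundamental cycles
   of S, and conversely a component of S yields a cut avoiding S. *)
Require Import Defs.
From mathcomp Require Import all_boot all_order all_algebra.
From mathcomp Require Import boolp classical_sets functions cardinality reals.
From mathcomp Require Import topology normedtype.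
From mathcomp Require Import ring lra.

Import Order.TTheory GRing.Theory Num.Theory.
Import numFieldNormedType.Exports.
Local Open Scope classical_set_scope.
Local Open Scope ring_scope.

Set Implicit Arguments.
Unset Strict Implicit.
Unset Printing Implicit Defensive.

(** * Spans of columns *)

Ltac mxring := apply/matrixP=> ? ?; rewrite !mxE; ring.

Definition supported {R : realType} {m} (J : {set 'I_m}) (w : 'cV[R]_m) : Prop :=
  forall a, a \notin J -> w a 0 = 0.

Definition cols_independent {R : realType} {d m} (M : 'M[R]_(d, m))
    (J : {set 'I_m}) : Prop :=
  forall w, supported J w -> M *m w = 0 -> w = 0.

Section Span.
Variables (R : realType) (d m : nat) (M : 'M[R]_(d, m)).
Implicit Types (J K : {set 'I_m}) (x y z w : 'cV[R]_m).

(** The condition bears on the image of [x] but is stated for [x] itself, so that later arguments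
    can move points of the cube. *)
Definition cols_span K x : Prop := exists2 w, supported K w & M *m x = M *m w.

Lemma cols_spanD K x y : cols_span K x -> cols_span K y -> cols_span K (x + y).
Proof.
move=> [v Kv Mv] [w Kw Mw]; exists (v + w); last by rewrite !mulmxDr Mv Mw.
by move=> a Ka; rewrite mxE Kv // Kw // addr0.
Qed.

Lemma cols_spanZ K c x : cols_span K x -> cols_span K (c *: x).
Proof.
move=> [v Kv Mv]; exists (c *: v); last by rewrite -!scalemxAr Mv.
by move=> a Ka; rewrite mxE Kv // mulr0.
Qed.

Lemma cols_spanN K x : cols_span K x -> cols_span K (- x).
Proof. by rewrite -scaleN1r; exact: cols_spanZ. Qed.

Lemma cols_spanB K x y : cols_span K x -> cols_span K y -> cols_span K (x - y).
Proof. by move=> ? /cols_spanN; exact: cols_spanD. Qed.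

Lemma supported_span K x : supported K x -> cols_span K x.
Proof. by exists x. Qed.

Lemma cols_spanS J K x : J \subset K -> cols_span J x -> cols_span K x.
Proof.
move=> JK [w Jw Mw]; exists w => // a Ka; apply: Jw.
by apply: contra Ka; apply: (fintype.subsetP JK).
Qed.

Lemma cols_span_ker K x : M *m x = 0 -> cols_span K x.
Proof. by move=> Mx; exists 0; rewrite ?mulmx0 // => a _; rewrite mxE. Qed.

Lemma cols_span_setU1 K b x : cols_span (b |: K)%SET x ->
  exists t, cols_span K (x - t *: delta_mx b 0).
Proof.
move=> [w Kw Mw]; exists (w b 0); exists (w - w b 0 *: delta_mx b 0).
  move=> a Ka; rewrite !mxE eqxx andbT.
  case: (eqVneq a b) => [->|ab]; first by rewrite mulr1 subrr.
  by rewrite mulr0 subr0 Kw // in_setU1 negb_or ab Ka.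
by rewrite !mulmxBr Mw.
Qed.

Lemma mulmx_supported J x : supported J x ->
  M *m x = colsub (fun j : 'I_#|J| => enum_val j) M *m
           rowsub (fun j : 'I_#|J| => enum_val j) x.
Proof.
move=> Jx; apply/matrixP => i k; rewrite !mxE (bigID (mem J)) /=.
rewrite [X in _ + X]big1 ?addr0; last first.
  by move=> a Ja; rewrite (ord1 k) Jx ?mulr0.
by rewrite big_enum_val; apply: eq_bigr => j _; rewrite !mxE.
Qed.

Lemma rowsub_ext J (v : 'cV[R]_#|J|) :
  exists2 x : 'cV[R]_m, supported J x & rowsub (fun j : 'I_#|J| => enum_val j) x = v.
Proof.
exists (\col_a \sum_(j | enum_val j == a) v j 0).
  move=> a Ja; rewrite mxE big1 // => j /eqP ja.
  by move: Ja; rewrite -ja enum_valP.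
apply/matrixP => j k; rewrite (ord1 k) !mxE (big_pred1 j) // => i.
by rewrite (inj_eq enum_val_inj).
Qed.

Lemma cols_independentP J :
  row_free (colsub (fun j : 'I_#|J| => enum_val j) M)^T <-> cols_independent M J.
Proof.
split=> [fr w Jw Mw|ind].
  have: (rowsub (fun j : 'I_#|J| => enum_val j) w)^T = 0.
    apply: (row_free_inj fr); rewrite -trmx_mul -(mulmx_supported Jw) Mw.
    by rewrite trmx0 mul0mx.
  move=> w0; apply/matrixP => a k; rewrite (ord1 k) mxE.
  have [Ja|/Jw//] := boolP (a \in J).
  have /matrixP/(_ 0 (enum_rank_in Ja a)) := w0.
  by rewrite !mxE enum_rankK_in.
apply: inj_row_free => v vM.
have [w Jw wv] := rowsub_ext v^T.
suff w0 : w = 0.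
  by apply: (can_inj (@trmxK _ _ _)); rewrite -wv w0; apply/matrixP => i j; rewrite !mxE.
apply: ind => //; rewrite (mulmx_supported Jw) wv.
by apply: (can_inj (@trmxK _ _ _)); rewrite trmx_mul trmxK vM trmx0.
Qed.

Lemma cols_independentS J K : J \subset K -> cols_independent M K -> cols_independent M J.
Proof.
move=> JK ind w Jw; apply: ind => a Ka; apply: Jw.
by apply: contra Ka; apply: (fintype.subsetP JK).
Qed.

(** A left inverse of the independent columns gives a form with prescribed values on them. It serves
    to bound lines and to expose faces of cells. *)
Lemma cols_independent_dual J (f : 'I_m -> R) : cols_independent M J ->
  exists phi : 'rV[R]_d, forall a, a \in J -> (phi *m M) 0 a = f a.
Proof.
move=> /cols_independentP/row_freeP[B NB].
exists ((\row_j f (enum_val j)) *m B^T) => a Ja.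
have /(congr1 (fun N => ((\row_j f (enum_val j)) *m N^T) 0 (enum_rank_in Ja a))) := NB.
rewrite trmx1 mulmx1 [RHS]mxE enum_rankK_in // => <-.
rewrite trmx_mul trmxK !mulmxA !mxE; apply: eq_bigr => i _.
by rewrite !mxE enum_rankK_in.
Qed.

Lemma cols_independent_card_span J x : cols_independent M J -> #|J| = d -> cols_span J x.
Proof.
move=> /cols_independentP fr Jd.
have full : row_full (colsub (fun j : 'I_#|J| => enum_val j) M)^T.
  by rewrite /row_full eqn_leq rank_leq_col /= -{1}Jd; move: fr => /eqP->.
have /submxP[D xD] := submx_full (M *m x)^T full.
have [w Jw wD] := rowsub_ext D^T.
exists w => //; rewrite (mulmx_supported Jw) wD.
by apply: (can_inj (@trmxK _ _ _)); rewrite xD trmx_mul trmxK.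
Qed.

End Span.

(** * The section over an independent set of directions *)

Definition unit_cube {R : realType} {m} : set 'cV[R]_m :=
  [set x | forall a, 0 <= x a 0 <= 1].

Lemma cube_face_sub {R : realType} {m} (s : cube_label m) :
  cube_face s `<=` @unit_cube R m.
Proof.
move=> x sx a; move: (sx a); case: (s a) => [e ->|//].
by rewrite ler0n lern1; case: e.
Qed.

(** A coordinate strictly between 0 and 1 must be free in [s]. *)
Lemma cube_face_line {R : realType} {m} (s : cube_label m) (x : 'cV[R]_m) b t :
  cube_face s x -> 0 < x b 0 < 1 -> 0 <= x b 0 + t <= 1 ->
  cube_face s (x + t *: delta_mx b 0).
Proof.
move=> sx xb xbt a; move: (sx a); rewrite !mxE eqxx andbT.
case: (eqVneq a b) => [->|_]; last by rewrite mulr0 addr0.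
rewrite mulr1; case: (s b) => [e xe|//].
by move: xb; rewrite xe; case: e {xe} => /=; rewrite ltxx ?andbF.
Qed.

Section UniqueSection.
Variables (R : realType) (d m : nat) (M : 'M[R]_(d, m)) (X : {set cube_label m}).

Definition faces_union : set 'cV[R]_m := [set x | exists2 s, s \in X & cube_face s x].
Let U := faces_union.

Hypothesis surjU : forall z, unit_cube z -> exists2 x, U x & M *m x = M *m z.
Hypothesis injU : forall x x', U x -> U x' -> M *m x = M *m x' -> x = x'.

Definition agree (K : {set 'I_m}) (x y : 'cV[R]_m) := forall a, a \in K -> x a 0 = y a 0.

(** For empty [K] the two halves are injectivity and surjectivity of [M] from [U] onto the image of
    the cube. In general, prescribing the coordinates in [K] makes up for the directions factored
    out. *)
Definition unique_section (K : {set 'I_m}) (y : 'cV[R]_m) : Prop :=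
  (forall x x', U x -> U x' -> agree K x y -> agree K x' y ->
     cols_span M K (x - x') -> x = x') /\
  (forall z, unit_cube z -> exists x, [/\ U x, agree K x y & cols_span M K (x - z)]).

Lemma subU x : U x -> unit_cube x.
Proof. by case=> s _; exact: cube_face_sub. Qed.

Lemma cube_line (x : 'cV[R]_m) b t : unit_cube x -> 0 <= x b 0 + t <= 1 ->
  unit_cube (x + t *: delta_mx b 0).
Proof.
move=> cx cb a; rewrite !mxE eqxx andbT.
by case: (eqVneq a b) => [->|_]; rewrite ?mulr1 // mulr0 addr0.
Qed.

Lemma U_line x b t : U x -> 0 < x b 0 < 1 -> 0 <= x b 0 + t <= 1 ->
  U (x + t *: delta_mx b 0).
Proof. by move=> [s Xs sx] h1 h2; exists s => //; apply: cube_face_line. Qed.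

Lemma agree_line (K : {set 'I_m}) x y b t : b \notin K -> agree K x y ->
  agree K (x + t *: delta_mx b 0) y.
Proof.
move=> Kb xy a Ka; rewrite !mxE eqxx andbT.
case: eqVneq => [ab|_]; first by rewrite -ab Ka in Kb.
by rewrite mulr0 addr0 xy.
Qed.

Lemma line_coord (x : 'cV[R]_m) b t : (x + t *: delta_mx b 0) b 0 = x b 0 + t.
Proof. by rewrite !mxE !eqxx mulr1. Qed.

Section Step.
Variables (K : {set 'I_m}) (b : 'I_m) (y : 'cV[R]_m).
Hypothesis Kb : b \notin K.
Hypothesis indepbK : cols_independent M (b |: K)%SET.
Hypothesis yb : 0 < y b 0 < 1.
Hypothesis uniqK : forall x x', U x -> U x' -> agree K x y -> agree K x' y ->
     cols_span M K (x - x') -> x = x'.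
Hypothesis existsK : forall z, unit_cube z ->
  exists x, [/\ U x, agree K x y & cols_span M K (x - z)].

(** * Existence: a line in direction [b] modulo the span of [K] *)

Section Line.
Variable z : 'cV[R]_m.
Hypothesis cz : unit_cube z.
(** Modulo the columns in [K], the image of [x] is the point with parameter [t] on the line through
    the image of [z] in direction [b]. *)
Let above t (x : 'cV[R]_m) := cols_span M K (x - z - t *: delta_mx b 0).

Let T : set R := [set t | exists2 z', unit_cube z' & above t z'].

(** Over each [t] in [T] the section has exactly one point, by [T_lift] and [above_inj]; [E e] is a
    level set of its coordinate [b]. *)
Let E (e : R) : set R :=
  [set t | exists x, [/\ U x, agree K x y, above t x & x b 0 = e]].

Let Es (e : R) (s : cube_label m) : set R :=
  [set t | exists x, [/\ cube_face s x, agree K x y, above t x & x b 0 = e]].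

Lemma E_bigcup e : E e = \bigcup_(s in [set` X]) Es e s.
Proof.
apply/seteqP; split=> t.
  by move=> [x [[s Xs sx] h1 h2 h3]]; exists s => //; exists x.
by move=> [s Xs [x [sx h1 h2 h3]]]; exists x; split=> //; exists s.
Qed.

Lemma cube_face_convex3 (s : cube_label m) (x1 x2 x3 : 'cV[R]_m) a b' c :
  cube_face s x1 -> cube_face s x2 -> cube_face s x3 ->
  0 <= a -> 0 <= b' -> 0 <= c -> a + b' + c = 1 ->
  cube_face s (a *: x1 + b' *: x2 + c *: x3).
Proof.
move=> h1 h2 h3 a0 b0 c0 abc i; rewrite !mxE.
move: (h1 i) (h2 i) (h3 i); case: (s i) => [e -> -> ->|i1 i2 i3].
  by rewrite -!mulrDl abc mul1r.
by nra.
Qed.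

Lemma closed_affine_range (s : cube_label m) (x v : 'cV[R]_m) :
  closed [set t : R | cube_face s (x + t *: v)].
Proof.
have -> : [set t : R | cube_face s (x + t *: v)] =
  \bigcap_(a in [set: 'I_m]) [set t : R | match s a with
     | None => 0 <= x a 0 + t * v a 0 <= 1
     | Some e => x a 0 + t * v a 0 = e%:R end].
  apply/seteqP; split=> t /= h a; last move: (h a I); rewrite ?mxE //.
  by move=> _; move: (h a); rewrite !mxE.
have cont (a : 'I_m) : continuous (fun t : R => x a 0 + t * v a 0).
  move=> t; apply: cvgD; first exact: cvg_cst.
  by apply: cvgMl; exact: cvg_id.
have closedp a (D : set R) : closed D -> closed [set t | D (x a 0 + t * v a 0)].
  by move=> cD; apply: (@preimage_closed _ _ _ D) => // t _; exact: cont.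
apply: closed_bigI => a _ /=; case: (s a) => [e|].
  by apply: (closedp a [set u | u = e%:R]); exact: closed_eq.
have -> : [set t : R | 0 <= x a 0 + t * v a 0 <= 1] =
   [set t : R | 0 <= x a 0 + t * v a 0] `&` [set t | x a 0 + t * v a 0 <= 1].
  by apply/seteqP; split=> t /= => [/andP[]|[-> ->]].
apply: closedI.
  by apply: (closedp a [set u | 0 <= u]); exact: closed_ge.
by apply: (closedp a [set u | u <= 1]); exact: closed_le.
Qed.

(* The points over Es e s are an affine function of t, by uniqueness: a relation
   among three of them would move their barycentre inside the face. *)
Lemma closed_Es e s : s \in X -> closed (Es e s).
Proof.
move=> Xs.
have [[t1 [t2 [/eqP t12 [x1 [sx1 Kx1 ax1 bx1]] [x2 [sx2 Kx2 ax2 bx2]]]]]|no] :=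
  pselect (exists t1 t2, [/\ t1 <> t2, Es e s t1 & Es e s t2]); last first.
  have [[t0 Et0]|no0] := pselect (exists t0, Es e s t0); last first.
    suff -> : Es e s = set0 by exact: closed0.
    by apply/seteqP; split=> // t Et; apply: no0; exists t.
  suff -> : Es e s = [set t | t = t0] by exact: closed_eq.
  apply/seteqP; split=> t /=; last by move->.
  by move=> Et; apply: contrapT => tt0; apply: no; exists t, t0.
(* [v] is the slope of the section between [t1] and [t2]; [xt] is the affine map through [x1] and
   [x2]. *)
pose v := (t2 - t1)^-1 *: (x2 - x1).
pose xt t := x1 - t1 *: v + t *: v.
have t21 : t2 - t1 != 0 by rewrite subr_eq0 eq_sym.
have spanx12 : cols_span M K (x2 - x1 - (t2 - t1) *: delta_mx b 0).
  have -> : x2 - x1 - (t2 - t1) *: delta_mx b 0 =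
    (x2 - z - t2 *: delta_mx b 0) - (x1 - z - t1 *: delta_mx b 0) by mxring.
  exact: cols_spanB.
have spanv : cols_span M K (v - delta_mx b 0).
  have -> : v - delta_mx b 0 =
     (t2 - t1)^-1 *: (x2 - x1 - (t2 - t1) *: delta_mx b 0).
    by rewrite scalerBr scalerA mulVf // scale1r.
  exact: cols_spanZ.
have spanxt t : above t (xt t).
  rewrite /above.
  have -> : xt t - z - t *: delta_mx b 0 =
    (x1 - z - t1 *: delta_mx b 0) + (t - t1) *: (v - delta_mx b 0) by mxring.
  by apply: cols_spanD => //; apply: cols_spanZ.
have vb a : x1 a 0 = x2 a 0 -> forall t, xt t a 0 = x1 a 0.
  by move=> xa t; rewrite /xt /v !mxE xa; ring.
suff -> : Es e s = [set t | cube_face s (xt t)] by exact: closed_affine_range.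
apply/seteqP; split=> t /=; last first.
  move=> st; exists (xt t); split=> //; last by rewrite vb // bx1 bx2.
  by move=> a Ka; rewrite vb ?Kx1 ?Kx2.
move=> [x [sx Kx ax bx]].
suff -> : xt t = x by [].
pose l := (t - t1) / (t2 - t1).
have xtE : xt t = (1 - l) *: x1 + l *: x2.
  by rewrite /xt /v /l; apply/matrixP=> i j; rewrite !mxE; field.
pose c := 3^-1 *: x + 3^-1 *: x1 + 3^-1 *: x2.
have nl : 0 <= `|l| by exact: normr_ge0.
have nlV : 0 < 1 + `|l| by lra.
(* Moving [c] by [eps] times [x - xt t] changes the weights of [x1] and [x2] by at most
   [eps * (1 + |l|)], which is 1/3, so they stay nonnegative. *)
pose eps := 3^-1 * (1 + `|l|)^-1.
have eps0 : 0 < eps by rewrite mulr_gt0 ?invr_gt0.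
have epsl : eps * (1 + `|l|) = 3^-1 by rewrite /eps mulfVK // gt_eqF.
have l1 := ler_norm l.
have l2 : - l <= `|l| by rewrite -normrN ler_norm.
have Uc : U c by exists s => //; apply: cube_face_convex3 => //; lra.
have Uc' : U (c + eps *: (x - xt t)).
  exists s => //.
  have -> : c + eps *: (x - xt t) = (3^-1 + eps) *: x + (3^-1 - eps * (1 - l)) *: x1 +
     (3^-1 - eps * l) *: x2.
    by rewrite xtE /c; mxring.
  by apply: cube_face_convex3 => //; [lra|nra|nra|lra].
have Kc : agree K c y.
  by move=> a Ka; rewrite !mxE Kx // Kx1 // Kx2 //; field.
have Kc' : agree K (c + eps *: (x - xt t)) y.
  move=> a Ka.
  have -> : (c + eps *: (x - xt t)) a 0 = c a 0 + eps * (x a 0 - xt t a 0).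
    by rewrite !mxE.
  by rewrite vb ?Kc ?Kx ?Kx1 ?Kx2 // subrr mulr0 addr0.
have := uniqK Uc' Uc Kc' Kc.
have -> : c + eps *: (x - xt t) - c =
    eps *: ((x - z - t *: delta_mx b 0) - (xt t - z - t *: delta_mx b 0)).
  by mxring.
move=> /(_ (cols_spanZ _ (cols_spanB ax (spanxt t)))) /eqP.
rewrite -subr_eq0 addrAC subrr add0r scaler_eq0 gt_eqF //= subr_eq0.
by move=> /eqP.
Qed.

Lemma closed_E e : closed (E e).
Proof.
rewrite E_bigcup; apply: closed_bigcup => [|s Xs]; last exact: closed_Es.
exact: finite_finset.
Qed.

Lemma T_lift t : T t -> exists x, [/\ U x, agree K x y & above t x].
Proof.
move=> [z' cz' az']; have [x [Ux Kx sx]] := existsK cz'.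
exists x; split=> //; rewrite /above.
have -> : x - z - t *: delta_mx b 0 = (x - z') + (z' - z - t *: delta_mx b 0) by mxring.
exact: cols_spanD.
Qed.

Lemma above_inj t x x' : U x -> U x' -> agree K x y -> agree K x' y ->
  above t x -> above t x' -> x = x'.
Proof.
move=> Ux Ux' Kx Kx' ax ax'; apply: uniqK => //.
have -> : x - x' = (x - z - t *: delta_mx b 0) - (x' - z - t *: delta_mx b 0) by mxring.
exact: cols_spanB.
Qed.

Lemma T_convex p q t : T p -> T q -> p <= t <= q -> T t.
Proof.
move=> [zp cp ap] [zq cq aq] /andP[pt tq].
have [pq|pq] := eqVneq p q.
  by exists zp => //; have -> : t = p by [apply/eqP; rewrite eq_le pt pq tq].
have qp : 0 < q - p by rewrite subr_gt0 lt_neqAle pq (le_trans pt tq).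
pose l := (t - p) / (q - p).
have l0 : 0 <= l by apply: divr_ge0; lra.
have l1 : l <= 1 by rewrite ler_pdivrMr // mul1r lerD2r.
exists ((1 - l) *: zp + l *: zq).
  by move=> a; rewrite !mxE; move: (cp a) (cq a); nra.
have te : t = (1 - l) * p + l * q by rewrite /l; field; rewrite gt_eqF.
rewrite /above.
have -> : (1 - l) *: zp + l *: zq - z - t *: delta_mx b 0 =
  (1 - l) *: (zp - z - p *: delta_mx b 0) + l *: (zq - z - q *: delta_mx b 0).
  by rewrite [in LHS]te; mxring.
by apply: cols_spanD; apply: cols_spanZ.
Qed.

(** [E e] and [E e'] are disjoint closed sets covering the segment, so each is open and closed in
    it, and a segment is connected. *)
Lemma no_jump p q (e e' : R) : e != e' -> T p -> T q -> p <= q ->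
  (forall t, p <= t <= q -> E e t \/ E e' t) ->
  forall t t', p <= t <= q -> p <= t' <= q -> E e t -> E e t'.
Proof.
move=> ee' Tp Tq pq cover t t' tpq t'pq Et.
have disj r : E e r -> E e' r -> False.
  move=> [x [Ux Kx ax bx]] [x' [Ux' Kx' ax' bx']].
  by move: ee'; rewrite -bx -bx' (above_inj Ux Ux' Kx Kx' ax ax') eqxx.
have := @segment_connected R p q (`[p, q] `&` E e).
have h1 : `[p, q] `&` E e !=set0 by exists t; split=> //=; rewrite in_itv.
have h2 : exists2 C, open C & `[p, q] `&` E e = `[p, q] `&` C.
  exists (~` E e'); first by rewrite openC; exact: closed_E.
  apply/seteqP; split=> r /= [rpq Er]; split=> //; first by move=> /(disj _ Er).
  by move: rpq; rewrite in_itv /= => /cover[].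
have h3 : exists2 C, closed C & `[p, q] `&` E e = `[p, q] `&` C.
  by exists (E e) => //; exact: closed_E.
move=> /(_ h1 h2 h3) => E'.
suff : (`[p, q] `&` E e) t' by case.
by rewrite E' /= in_itv.
Qed.

(** A form that is 1 on column [b] and 0 on the columns in [K] recovers [t] from [M *m (z' - z)],
    and differences of cube points are bounded. *)
Lemma T_bounded : exists C, forall t, T t -> `|t| <= C.
Proof.
have [phi hphi] := cols_independent_dual (fun a => (a == b)%:R) indepbK.
exists (\sum_a `|(phi *m M) 0 a|) => t [z' cz' [w Kw Mw]].
have tE : t = (phi *m M *m (z' - z)) 0 0.
  have : phi *m (M *m w) = 0.
    rewrite mulmxA; apply/matrixP=> i j; rewrite mxE [RHS]mxE big1 // => a _.
    rewrite (ord1 i) (ord1 j).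
    have [Ka|/Kw->] := boolP (a \in K); last by rewrite mulr0.
    rewrite hphi ?inE ?Ka ?orbT // (_ : (a == b) = false) ?mul0r //.
    by apply: contraNF Kb => /eqP<-.
  rewrite -Mw mulmxBr mulmxBr => /eqP; rewrite subr_eq0 => /eqP.
  rewrite mulmxA => ->; rewrite -scalemxAr -scalemxAr mulmxA mxE.
  rewrite mxE (bigD1 b) //= big1 ?addr0.
    by rewrite hphi ?setU11 // !mxE !eqxx !mulr1.
  by move=> a /negPf ab; rewrite !mxE ab mulr0.
rewrite tE mxE; apply: le_trans (ler_norm_sum _ _ _) _.
apply: ler_sum => a _; rewrite normrM ler_piMr // !mxE ler_norml.
by move: (cz' a) (cz a); lra.
Qed.

Lemma T0 : T 0.
Proof.
exists z => //; rewrite /above scale0r subr0 subrr.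
by apply: cols_span_ker; rewrite mulmx0.
Qed.

Lemma T_line t x r : unit_cube x -> above t x -> 0 <= x b 0 + r <= 1 -> T (t + r).
Proof.
move=> cx ax h; exists (x + r *: delta_mx b 0); first exact: cube_line.
rewrite /above (_ : _ - _ = x - z - t *: delta_mx b 0) //.
by mxring.
Qed.

Lemma segment_crossing p q : T p -> T q -> p <= q ->
  (forall t, p <= t <= q -> E 0 t \/ E 1 t) \/
  exists t x, [/\ p <= t <= q, U x, agree K x y, above t x & 0 < x b 0 < 1].
Proof.
move=> Tp Tq pq.
have [|no] := pselect (exists t x,
  [/\ p <= t <= q, U x, agree K x y, above t x & 0 < x b 0 < 1]).
  by right.
left=> t tpq; have [x [Ux Kx ax]] := T_lift (T_convex Tp Tq tpq).
have [x0|x0] := eqVneq (x b 0) 0; first by left; exists x.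
have [x1|x1] := eqVneq (x b 0) 1; first by right; exists x.
exfalso; apply: no; exists t, x; split=> //.
by rewrite !lt_neqAle x1 eq_sym x0 /=; exact: (subU Ux b).
Qed.

(** Otherwise coordinate [b] of the section takes only the values 0 and 1. Where it is 0 one can
    move up by 1 inside the cube, and [no_jump] keeps the value 0; iterating leaves the bounded set
    [T]. From the value 1 the same happens downwards. *)
Lemma crossing : exists t x, [/\ U x, agree K x y, above t x & 0 < x b 0 < 1].
Proof.
apply: contrapT => no.
have cover p q : T p -> T q -> p <= q -> forall t, p <= t <= q -> E 0 t \/ E 1 t.
  move=> Tp Tq pq; have [//|[t [x [_ h1 h2 h3 h4]]]] := segment_crossing Tp Tq pq.
  by exfalso; apply: no; exists t, x.
have TE e t : E e t -> exists2 x, unit_cube x & above t x /\ x b 0 = e.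
  by move=> [x [Ux _ ax xe]]; exists x; first exact: subU.
have up n : E 0 0 -> E 0 n%:R.
  move=> E00; elim: n => [//|n IHn].
  have [x cx [ax bx]] := TE _ _ IHn.
  have Tn : T n%:R by exists x.
  have Tn1 : T (n%:R + 1) by apply: (T_line cx ax); rewrite bx; lra.
  have le1 : n%:R <= n%:R + 1 :> R by lra.
  rewrite -natr1; apply: (no_jump _ Tn Tn1 le1 (cover _ _ Tn Tn1 le1)) IHn; try lra.
have down n : E 1 0 -> E 1 (- n%:R).
  move=> E10; elim: n => [|n IHn]; first by rewrite oppr0.
  have [x cx [ax bx]] := TE _ _ IHn.
  have Tn : T (- n%:R) by exists x.
  have Tn1 : T (- n%:R - 1) by apply: (T_line cx ax); rewrite bx; lra.
  have le1 : - n%:R - 1 <= - n%:R :> R by lra.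
  have cover' t : - n%:R - 1 <= t <= - n%:R -> E 1 t \/ E 0 t.
    by move=> /(cover _ _ Tn1 Tn le1)[]; [right|left].
  rewrite -natr1 opprD; apply: (no_jump _ Tn1 Tn le1 cover') IHn; try lra.
have [C hC] := T_bounded.
have big (t : R) : `|t| = (Num.bound C)%:R -> ~ T t.
  move=> tC /hC; rewrite tC leNgt; have := hC 0 T0; rewrite normr0 => /archi_boundP ->.
  by [].
have [||] := cover 0 0 T0 T0 (lexx _) 0; first lra.
  move=> /(up (Num.bound C))/TE[x cx [ax _]]; apply: (big (Num.bound C)%:R).
    by rewrite normr_nat.
  by exists x.
move=> /(down (Num.bound C))/TE[x cx [ax _]]; apply: (big (- (Num.bound C)%:R)).
  by rewrite normrN normr_nat.
by exists x.
Qed.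

End Line.

(** * Uniqueness: two section points at the same height over one line *)

Definition line_pair (t : R) x x' := [/\ U x, U x', agree K x y, agree K x' y &
  x b 0 = y b 0 /\ x' b 0 = y b 0 /\ cols_span M K (x - x' - t *: delta_mx b 0)].

(** If [t <= 1], sliding [x'] by [t - y b 0] and [x] by [- y b 0] brings both over the same point,
    with coordinates [t] and 0 at [b], against uniqueness for [K]. *)
Lemma line_pair_gt1 t x x' : line_pair t x x' -> 0 < t -> 1 < t.
Proof.
have yb' := yb; move=> [Ux Ux' Kx Kx' [bx [bx' sx]]] t0; rewrite ltNge; apply/negP => t1.
have : x' + (t - y b 0) *: delta_mx b 0 = x + (- y b 0) *: delta_mx b 0.
  apply: uniqK.
  - by apply: U_line => //; rewrite bx'; lra.
  - by apply: U_line => //; rewrite bx; lra.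
  - exact: agree_line.
  - exact: agree_line.
  - rewrite (_ : _ - _ = - (x - x' - t *: delta_mx b 0)); first exact: cols_spanN.
    by mxring.
move=> /matrixP/(_ b 0); rewrite !line_coord bx bx'; lra.
Qed.

(** Raise [x'] until its coordinate [b] is 1 and lower [x] until it is 0. As [t] exceeds 1, the
    first point still precedes the second on the line, so the section has a point with coordinate in
    (0,1) between them. *)
Lemma line_pair_split t x x' : line_pair t x x' -> 0 < t ->
  exists t' x'', [/\ 0 < t' < t, line_pair t' x'' x' & line_pair (t - t') x x''].
Proof.
have yb' := yb; move=> P t0; have t1 := line_pair_gt1 P t0.
move: P => [Ux Ux' Kx Kx' [bx [bx' sx]]].
have cx' := subU Ux'.
have [c cE] : exists c, c = y b 0 by exists (y b 0).
pose p := x' + (1 - c) *: delta_mx b 0.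
pose q := x + (- c) *: delta_mx b 0.
have Up : U p by apply: U_line => //; rewrite bx'; lra.
have Uq : U q by apply: U_line => //; rewrite bx; lra.
have Kp : agree K p y by exact: agree_line.
have Kq : agree K q y by exact: agree_line.
have ap : cols_span M K (p - x' - (1 - c) *: delta_mx b 0).
  by apply: cols_span_ker; rewrite (_ : _ - _ = 0) ?mulmx0 // /p; mxring.
have aq : cols_span M K (q - x' - (t - c) *: delta_mx b 0).
  rewrite (_ : _ - _ = x - x' - t *: delta_mx b 0) //.
  by rewrite /q; mxring.
have Tp : exists2 z', unit_cube z' & cols_span M K (z' - x' - (1 - c) *: delta_mx b 0).
  by exists p => //; exact: subU.
have Tq : exists2 z', unit_cube z' & cols_span M K (z' - x' - (t - c) *: delta_mx b 0).
  by exists q => //; exact: subU.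
have pq : 1 - c <= t - c by lra.
have bp : p b 0 = 1 by rewrite line_coord bx'; lra.
have bq : q b 0 = 0 by rewrite line_coord bx; lra.
have [cover|[t' [x'' [ht' Ux'' Kx'' ax'' bx'']]]] := segment_crossing Tp Tq pq.
  (* If only 0 and 1 occurred, the value 1 at [p] would persist up to [q], where it is 0. *)
  exfalso.
  have [||u [Uu Ku au bu]] := no_jump (oner_neq0 _) Tp Tq pq
    (fun r hr => (or_comm _ _).1 (cover r hr)) _ _
    (ex_intro _ p (And4 Up Kp ap bp)) (t' := t - c); try lra.
  by move: bu; rewrite (above_inj Uu Uq Ku Kq au aq) bq => /eqP; rewrite eq_sym oner_eq0.
(* Sliding [x''] to height [c] moves it to parameter [s], strictly between 0 and [t] because
   [1 - c <= t' <= t - c] and [0 < x'' b 0 < 1]. *)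
pose s := t' + (c - x'' b 0).
exists s, (x'' + (c - x'' b 0) *: delta_mx b 0).
have Us : U (x'' + (c - x'' b 0) *: delta_mx b 0).
  by apply: U_line => //; lra.
have Ks : agree K (x'' + (c - x'' b 0) *: delta_mx b 0) y by exact: agree_line.
have bs : (x'' + (c - x'' b 0) *: delta_mx b 0) b 0 = y b 0.
  by rewrite line_coord; lra.
split.
- by rewrite /s; lra.
- split=> //; split=> //; split=> //.
  rewrite (_ : _ - _ = x'' - x' - t' *: delta_mx b 0) //.
  by rewrite /s; mxring.
- split=> //; split=> //; split=> //.
  rewrite (_ : _ - _ = (x - x' - t *: delta_mx b 0) - (x'' - x' - t' *: delta_mx b 0)).
    exact: cols_spanB.
  by rewrite /s; mxring.
Qed.

(** Each split replaces [t] by [t - t'] with [t' > 1], so [n] splits exhaust it. *)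
Lemma line_pair_false n t x x' : line_pair t x x' -> 0 < t <= n%:R -> False.
Proof.
elim: n t x x' => [|n IHn] t x x' P; first by lra.
move=> /andP[t0 tn]; have [t' [x'' [ht' P' P'']]] := line_pair_split P t0.
apply: IHn P'' _; move: tn; rewrite -natr1 => tn.
have := line_pair_gt1 P'; lra.
Qed.

Lemma unique_section_step : unique_section (b |: K)%SET y.
Proof.
have yb' := yb; split=> [x x' Ux Ux' Kx Kx' sx|z cz].
  have [t st] := cols_span_setU1 sx.
  have KbK : forall v, agree (b |: K)%SET v y -> agree K v y.
    by move=> v h a Ka; apply: h; rewrite setU1r.
  have bv : forall v, agree (b |: K)%SET v y -> v b 0 = y b 0.
    by move=> v; apply; rewrite setU11.
  have P : line_pair t x x' by split; auto.
  have P' : line_pair (- t) x' x.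
    split; auto; split; auto; split; auto.
    rewrite (_ : _ - _ = - (x - x' - t *: delta_mx b 0)); first exact: cols_spanN.
    by mxring.
  have [t0|t0|t0] := ltgtP t 0.
  - exfalso; apply: (line_pair_false (n := Num.bound (- t)) P').
    by rewrite oppr_gt0 t0 /= ltW // archi_boundP // oppr_ge0 ltW.
  - exfalso; apply: (line_pair_false (n := Num.bound t) P).
    by rewrite t0 /= ltW // archi_boundP // ltW.
  by apply: uniqK; auto; move: st; rewrite t0 scale0r subr0.
have [t [x [Ux Kx ax bx]]] := crossing cz.
exists (x + (y b 0 - x b 0) *: delta_mx b 0); split.
- by apply: U_line => //; lra.
- move=> a /setU1P[->|Ka]; first by rewrite line_coord; lra.
  exact: (agree_line (y b 0 - x b 0) Kb Kx Ka).
rewrite (_ : _ - _ = (x - z - t *: delta_mx b 0) +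
    (y b 0 - x b 0 + t) *: delta_mx b 0); last by mxring.
apply: cols_spanD; first by apply: cols_spanS ax; exact: finset.subsetUr.
apply: cols_spanZ; apply: supported_span => a.
by rewrite in_setU1 negb_or mxE => /andP[/negPf-> _].
Qed.

End Step.

Lemma unique_sectionP (J : {set 'I_m}) (y : 'cV[R]_m) : cols_independent M J ->
  (forall a, a \in J -> 0 < y a 0 < 1) -> unique_section J y.
Proof.
have [n] := ubnP #|J|; elim: n J => // n IHn J Jn indJ yJ.
have [->|/finset.set0Pn[b Jb]] := eqVneq J finset.set0.
  split=> [x x' Ux Ux' _ _ [w w0 Mw]|z /surjU[x Ux Mx]].
    apply: injU => //; apply/eqP; rewrite -subr_eq0 -mulmxBr Mw.
    suff -> : w = 0 by rewrite mulmx0.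
    by apply/matrixP=> i j; rewrite (ord1 j) w0 ?inE // mxE.
  exists x; split=> //; first by move=> a; rewrite inE.
  by apply: cols_span_ker; rewrite mulmxBr Mx subrr.
have JbJ : (J :\ b)%SET \subset J by exact: finset.subD1set.
have [||uniqK existsK] := IHn (J :\ b)%SET _ (cols_independentS JbJ indJ).
- by rewrite (cardsD1 b J) Jb in Jn.
- by move=> a /(fintype.subsetP JbJ); exact: yJ.
rewrite -(finset.setD1K Jb); apply: unique_section_step => //.
- by rewrite finset.setD11.
- by rewrite finset.setD1K.
- exact: yJ.
Qed.

End UniqueSection.

(** * Connectivity and the cycle matrix *)

Section Graph.
Variables (n m : nat) (G : digraph n m).
Implicit Types (S F : {set 'I_m}).

Let e S := linked G S [set: 'I_n]%SET.

Lemma linked_setT S x y : e S x y =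
  [exists a in S, ((src G a == x) && (tgt G a == y)) ||
                  ((src G a == y) && (tgt G a == x))].
Proof. by rewrite /e /linked !inE. Qed.

Lemma linked_sym S : symmetric (e S).
Proof.
by move=> x y; rewrite !linked_setT; apply: eq_existsb => a; rewrite orbC.
Qed.

Lemma linked_arc S a : a \in S -> e S (src G a) (tgt G a).
Proof. by move=> Sa; rewrite linked_setT; apply/existsP; exists a; rewrite Sa !eqxx. Qed.

Lemma incidenceE (g : 'cV[int]_m) v :
  (incidence G *m g) v 0 = \sum_a ((v == tgt G a)%:R - (v == src G a)%:R) * g a 0.
Proof. by rewrite mxE; apply: eq_bigr => a _; rewrite mxE. Qed.

Lemma incidence_delta a v :
  (incidence G *m delta_mx a (0 : 'I_1)) v 0 = (v == tgt G a)%:R - (v == src G a)%:R.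
Proof.
rewrite incidenceE (bigD1 a) //= mxE !eqxx mulr1 big1 ?addr0 // => b ba.
by rewrite mxE (negPf ba) mulr0.
Qed.

(** Signs record the direction of travel. Since the vertices are distinct, the first arc has its end
    [x] off the rest of the path, so its entry was still 0 and entries stay in {-1, 0, 1}. *)
Lemma path_vector S x p : path (e S) x p -> uniq (x :: p) ->
  exists g : 'cV[int]_m,
    [/\ forall a, g a 0 = -1 \/ g a 0 = 0 \/ g a 0 = 1,
        forall a, g a 0 != 0 -> [&& a \in S, src G a \in x :: p & tgt G a \in x :: p]
      & forall v, (incidence G *m g) v 0 = (v == last x p)%:R - (v == x)%:R].
Proof.
elim: p x => [|y p IHp] x.
  move=> _ _; exists 0; split=> [a|a|v]; rewrite ?mulmx0 mxE ?subrr //=.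
  by right; left.
move=> /= /andP[exy yp] /andP[xyp uyp].
have [g [g1 gS gB]] := IHp y yp uyp.
move: exy; rewrite linked_setT => /existsP[b /andP[Sb bxy]].
have gb0 : g b 0 = 0.
  apply/eqP; apply: contraT => /gS/and3P[_ sb tb].
  by case/orP: bxy xyp sb tb => /andP[/eqP-> /eqP->] /negPf->.
pose c : int := if src G b == x then 1 else -1.
exists (g + c *: delta_mx b 0); split=> [a|a|v].
- rewrite !mxE eqxx andbT; have [->|_] := eqVneq a b.
    by rewrite gb0 add0r mulr1 /c; case: ifP; auto.
  by rewrite mulr0 addr0.
- rewrite !mxE eqxx andbT; have [-> _|_] := eqVneq a b.
    rewrite Sb; case/orP: bxy => /andP[/eqP-> /eqP->];
    by rewrite !in_cons !eqxx !orbT.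
  rewrite mulr0 addr0 => /gS/and3P[-> h1 h2] /=.
  by rewrite in_cons h1 orbT in_cons h2 orbT.
have xy : (x == y) = false.
  by apply: contraNF xyp => /eqP->; rewrite mem_head.
rewrite mulmxDr -scalemxAr mxE gB mxE incidence_delta /c.
case/orP: bxy => /andP[/eqP-> /eqP->]; first by rewrite eqxx /=; ring.
by rewrite [y == x]eq_sym xy; ring.
Qed.

(** A simple path in [S] from the head of [a] back to its tail is closed up by [a]. *)
Lemma fundamental_cycle S a : connected_on G S [set: 'I_n]%SET -> a \notin S ->
  exists g, [/\ oriented_cycle G g, g a 0 = 1
    & forall b, b != a -> g b 0 != 0 -> b \in S].
Proof.
move=> conn Sa.
have /connectP[p0 ep0 lp0] :=
  conn (tgt G a) (src G a) (finset.in_setT _) (finset.in_setT _).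
case/shortenP: ep0 lp0 => p ep up _ lp.
have [g [g1 gS gB]] := path_vector ep up.
have ga : g a 0 = 0.
  by apply/eqP; apply: contraT => /gS/and3P[]; rewrite (negPf Sa).
exists (g + delta_mx a 0); split.
- split=> [b|].
    rewrite !mxE eqxx andbT; have [->|_] := eqVneq b a; last by rewrite addr0.
    by rewrite ga add0r; auto.
  apply/matrixP => v j; rewrite (ord1 j) mulmxDr mxE gB incidence_delta -lp mxE.
  by ring.
- by rewrite !mxE !eqxx ga add0r.
- by move=> b ba; rewrite !mxE (negPf ba) addr0 => /gS/and3P[].
Qed.

Lemma connected_onS S F : S \subset F -> connected_on G S [set: 'I_n]%SET ->
  connected_on G F [set: 'I_n]%SET.
Proof.
move=> SF conn x y hx hy; apply: (connect_sub _ (conn x y hx hy)) => u v.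
rewrite -/(e S _ _) linked_setT => /existsP[a /andP[Sa ha]].
apply: connect1; rewrite -/(e F _ _) linked_setT; apply/existsP; exists a.
by rewrite (fintype.subsetP SF).
Qed.

Lemma sum_pred_eq (W : pred 'I_n) w : \sum_(v | W v) (v == w)%:R = (W w)%:R :> int.
Proof.
case Ww : (W w); first rewrite (bigD1 w) //= eqxx.
  by rewrite big1 ?addr0 // => v /andP[_ /negPf->].
by apply: big1 => v Wv; case: eqP Wv => // ->; rewrite Ww.
Qed.

(* An arc a carried by a cycle g of F is not a bridge: otherwise it is the only
   arc of F leaving a component of F minus a, across which g would have a
   nonzero net flow. *)
Lemma connected_del_cycle F g a : connected_on G F [set: 'I_n]%SET ->
  oriented_cycle G g -> (forall b, g b 0 <> 0 -> b \in F) -> g a 0 != 0 ->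
  connected_on G (F :\ a)%SET [set: 'I_n]%SET.
Proof.
move=> conn [_ gB] gF ga.
have csym : connect_sym (e (F :\ a)%SET) by exact/sym_connect_sym/linked_sym.
suff aa : connect (e (F :\ a)%SET) (src G a) (tgt G a).
  move=> x y hx hy; apply: (connect_sub _ (conn x y hx hy)) => u v.
  rewrite -/(e F _ _) linked_setT => /existsP[b /andP[Fb hb]].
  have [ba|ba] := eqVneq b a.
    by move: hb; rewrite ba => /orP[]/andP[/eqP<- /eqP<-] //; rewrite csym.
  apply: connect1; rewrite -/(e _ _ _) linked_setT; apply/existsP; exists b.
  by rewrite !inE ba Fb.
apply: contraT => naa.
pose W v : bool := connect (e (F :\ a)%SET) (src G a) v.
have : \sum_(v | W v) (incidence G *m g) v 0 = 0.
  by rewrite gB big1 // => v _; rewrite mxE.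
under eq_bigr do rewrite incidenceE.
rewrite exchange_big /= (bigD1 a) //= [X in _ + X]big1 ?addr0.
  rewrite -mulr_suml big_split /= sumrN.
  rewrite [X in X - _]big1 ?sub0r; last first.
    move=> v Wv; case: eqP => // vt; by rewrite vt /W (negPf naa) in Wv.
  rewrite (bigD1 (src G a)) ?big1 ?eqxx ?addr0 /=; last by rewrite /W connect0.
    by move=> /eqP; rewrite mulN1r oppr_eq0 (negPf ga).
  by move=> v /andP[_ /negPf->].
move=> b ba; have [->|gb] := eqVneq (g b 0) 0.
  by rewrite big1 // => v _; rewrite mulr0.
rewrite -mulr_suml big_split /= sumrN.
have Wb : W (src G b) = W (tgt G b).
  apply: same_connect_r; first exact: csym.
  by apply: connect1; apply: linked_arc; rewrite !inE ba gF //; exact/eqP.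
by rewrite !sum_pred_eq Wb subrr mul0r.
Qed.

Lemma spanning_subgraphP S : spanning_subgraph G S <-> connected_on G S [set: 'I_n]%SET.
Proof.
split=> [[F [FS [conn _]]]|]; first exact: connected_onS conn.
have [k] := ubnP #|S|; elim: k S => // k IHk S Sk conn.
have [[g [cg g0 gS]]|acyc] := pselect (exists g, [/\ oriented_cycle G g, g <> 0
  & forall a, g a 0 <> 0 -> a \in S]); last first.
  by exists S; split=> //; split.
have [a ga] : exists a, g a 0 != 0.
  apply: contrapT => no; apply: g0; apply/matrixP => a j; rewrite (ord1 j) mxE.
  by apply: contrapT => /eqP ga; apply: no; exists a.
have Sa : a \in S by apply: gS; exact/eqP.
have [|F [FS tF]] := IHk (S :\ a)%SET _ (connected_del_cycle conn cg gS ga).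
  by rewrite (cardsD1 a S) Sa in Sk.
by exists F; split=> //; apply: fintype.subset_trans FS (subD1set _ _).
Qed.

Lemma no_arcs_disconnected : (1 < n)%N -> ~ connected_on G finset.set0 [set: 'I_n]%SET.
Proof.
move=> n1 conn.
have n0 : (0 < n)%N by exact: ltnW.
have /connectP[[|z p] /=] :=
  conn (Ordinal n0) (Ordinal n1) (finset.in_setT _) (finset.in_setT _).
  by move=> _ /(congr1 val).
rewrite -/(e _ _ _) linked_setT => /andP[/existsP[a]].
by rewrite inE.
Qed.

Section CycleMatrix.
Variables (R : realType) (gam : 'I_(cyclomatic n m) -> 'cV[int]_m).
Hypothesis basis_gam : integral_cycle_basis G gam.

(** An oriented cycle is an integer combination of the basis cycles, and [w] is orthogonal to each
    of them. *)
Lemma oriented_cycle_orthogonal (g : 'cV[int]_m) (w : 'cV[R]_m) :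
  oriented_cycle G g -> cycle_matrix R gam *m w = 0 ->
  \sum_a (g a 0)%:~R * w a 0 = 0.
Proof.
move=> cg Gw; have [|z ->] := basis_gam.2 g; first by move=> H HH _ _; exact: HH.
transitivity (\sum_i (z i)%:~R * \sum_a (gam i a 0)%:~R * w a 0).
  under [RHS]eq_bigr do rewrite mulr_sumr.
  rewrite exchange_big; apply: eq_bigr => a _ /=.
  rewrite summxE rmorph_sum mulr_suml; apply: eq_bigr => i _.
  by rewrite mxE rmorphM /= mulrA.
apply: big1 => i _; have /matrixP/(_ i 0) := Gw; rewrite !mxE => Gwi.
rewrite -[RHS](mulr0 (z i)%:~R) -[in RHS]Gwi; congr (_ * _).
by apply: eq_bigr => a _; rewrite mxE.
Qed.

(** Entry [i] is the net flow of [gam i] summed over the vertices of [W], which vanishes for a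
    cycle. *)
Lemma cycle_matrix_cut (W : pred 'I_n) :
  cycle_matrix R gam *m (\col_a ((W (tgt G a))%:R - (W (src G a))%:R)) = 0.
Proof.
apply/matrixP=> i j; rewrite !mxE.
have [_ gB] := basis_gam.1 i.
have : (\sum_(v | W v) (incidence G *m gam i) v 0)%:~R = 0 :> R.
  by rewrite gB big1 // => v _; rewrite mxE.
under eq_bigr do rewrite incidenceE.
rewrite exchange_big => h; rewrite -[RHS]h rmorph_sum; apply: eq_bigr => a _ /=.
rewrite -mulr_suml big_split /= sumrN !mxE.
by rewrite !sum_pred_eq rmorphM rmorphB !rmorph_nat mulrC.
Qed.

End CycleMatrix.
End Graph.

(** * Cells of a fine tiling *)

Section CubeLabels.
Variables (R : realType) (m : nat).
Implicit Types (s t : cube_label m) (x y : 'cV[R]_m).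

Definition free_arcs s : {set 'I_m} := (~: fixed_arcs s)%SET.

Lemma free_arcsE s a : (a \in free_arcs s) = (s a == None).
Proof. by rewrite !inE negbK. Qed.

(** At 1/2 this is the centre of the face, which determines the label because 1/2 is neither 0 nor
    1; at 0 it is the vertex from which the generators of the cell start. *)
Definition face_point s (r : R) : 'cV[R]_m :=
  \col_a if s a is Some e then e%:R else r.

Lemma face_point_mem s r : 0 <= r <= 1 -> cube_face s (face_point s r).
Proof. by move=> hr a; rewrite mxE; case: (s a). Qed.

Lemma face_midpoint_mem s : cube_face s (face_point s 2^-1).
Proof. by apply: face_point_mem; lra. Qed.

Lemma face_midpoint_sub s t : cube_face t (face_point s 2^-1) ->
  forall a, t a = None \/ t a = s a.
Proof.
move=> ts a; move: (ts a); rewrite mxE; case: (t a) => [e|]; last by left.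
case: (s a) => [e'|] h.
  by right; move/eqP: h; rewrite eqr_nat; case: e e' => [] [].
by exfalso; move: h; case: e => /=; lra.
Qed.

Lemma cube_face_free s t : @cube_face R m s `<=` cube_face t ->
  free_arcs s \subset free_arcs t.
Proof.
move=> /(_ _ (face_midpoint_mem s))/face_midpoint_sub st.
by apply/fintype.subsetP => a; rewrite !free_arcsE => /eqP sa;
  case: (st a) => ->; rewrite ?sa.
Qed.

Lemma face_midpoint_inj s t :
  cube_face t (face_point s 2^-1) -> cube_face s (face_point t 2^-1) -> s = t.
Proof.
move=> /face_midpoint_sub st /face_midpoint_sub ts; apply/ffunP => a.
by case: (st a) => [ta|//]; case: (ts a) => // sa; rewrite sa ta.
Qed.

Lemma cube_face_inj s t : @cube_face R m s = cube_face t -> s = t.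
Proof.
by move=> st; apply: face_midpoint_inj; [rewrite -st|rewrite st];
  exact: face_midpoint_mem.
Qed.

Lemma face_sub_free s x y : cube_face s x -> cube_face s y ->
  supported (free_arcs s) (x - y).
Proof.
move=> sx sy a; rewrite free_arcsE; move: (sx a) (sy a); rewrite !mxE.
by case: (s a) => [e -> ->|//]; rewrite subrr.
Qed.

Lemma face_point0_supported s x : cube_face s x ->
  supported (free_arcs s) (x - face_point s 0).
Proof. by move=> sx; apply: face_sub_free => //; apply: face_point_mem; lra. Qed.

End CubeLabels.

Section Dimension.
Variables (R : realType) (d : nat).

Lemma has_dim_unique (C : set 'cV[R]_d) k k' : has_dim C k -> has_dim C k' -> k = k'.
Proof.
suff le i j (Ci : has_dim C i) (Cj : has_dim C j) : (i <= j)%N.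
  by move=> Ck Ck'; apply/eqP; rewrite eqn_leq !le.
case: Ci Cj => [x [M [Cx /eqP fM CM _]]] [x' [M' [_ /eqP fM' _ CM']]].
rewrite -fM -fM'; apply: mxrankS; apply/row_subP => l.
have -> : row l M = (x + (row l M)^T - x')^T - (x - x')^T.
  by apply/matrixP=> a b; rewrite !mxE; ring.
by apply: addmx_sub; rewrite ?eqmx_opp; apply: CM'.
Qed.

Lemma has_dim_zonotope p (N : 'M[R]_(d, p)) b : row_free N^T ->
  has_dim (zonotope N b) p.
Proof.
move=> fN; exists b, N^T; split=> // [|i|x [v _ <-]].
- by exists 0; rewrite ?mulmx0 ?add0r // => j /=; rewrite mxE lexx ler01.
- exists (delta_mx i 0); last first.
    by rewrite addrC -colE; congr (_ + _); apply/matrixP=> a j; rewrite !mxE.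
  by move=> j; rewrite mxE ler0n lern1 leq_b1.
- by rewrite addrK trmx_mul submxMl.
Qed.

End Dimension.

(** * Cells as images of cube faces *)

Section Tiling.
Variables (R : realType) (n m : nat) (I : pesp R n m).
Variable gam : 'I_(cyclomatic n m) -> 'cV[int]_m.
Let M := scaled_cycle_matrix I gam.
Let c0 := cycle_offset I gam.

(** The deleted columns contribute a constant, the image of the vertex whose free coordinates are
    0. *)
Lemma cell_image s : cell I gam s = [set M *m x + c0 | x in cube_face s].
Proof.
have offE : cell_offset I gam s = c0 + M *m face_point s 0.
  rewrite /cell_offset -/M -/c0; congr (_ + _); apply/matrixP => i j.
  rewrite summxE mxE big_mkcond /=; apply: eq_bigr => a _.
  rewrite [face_point _ _ _ _]mxE; case: (s a) => [[]|] /=; rewrite ?mulr1 ?mulr0 //.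
  by rewrite mxE.
apply/seteqP; split=> z [v cv <-].
  have [w Jw wv] := rowsub_ext v.
  exists (w + face_point s 0).
    move=> a; rewrite !mxE; case sa : (s a) => [e|].
      by rewrite Jw ?add0r // free_arcsE sa.
    have Ja : a \in free_arcs s by rewrite free_arcsE sa.
    by have := cv (enum_rank_in Ja a); rewrite -wv mxE enum_rankK_in // addr0.
  by rewrite mulmxDr (mulmx_supported M Jw) wv offE -addrA [X in _ + X]addrC.
have Jw := face_point0_supported cv.
exists (rowsub (fun j : 'I_#|free_arcs s| => enum_val j) (v - face_point s 0)).
  move=> j; rewrite !mxE; have := enum_valP j; rewrite free_arcsE => /eqP sj.
  by rewrite sj subr0; move: (cv (enum_val j)); rewrite sj.
have := mulmx_supported M Jw; rewrite offE mulmxBr => /eqP.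
rewrite subr_eq => /eqP ->.
by rewrite addrA addrAC.
Qed.

Hypothesis hI : pesp_instance I.

Lemma scale_gt0 a : 0 < (upper I a 0 - lower I a 0) / (period I)%:R.
Proof. by case: hI => _ _ _ T0 /(_ a)[_ /andP[lu _]]; rewrite divr_gt0 ?ltr0n. Qed.

Lemma cycle_offset_zonotope_image :
  cycle_offset_zonotope I gam = [set M *m x + c0 | x in unit_cube].
Proof.
have lu a : 0 < upper I a 0 - lower I a 0.
  by case: hI => _ _ _ _ /(_ a)[_ /andP[]].
have img (x : 'cV[R]_m) : (period I)%:R^-1 *: (cycle_matrix R gam *m
    (\col_a (lower I a 0 + (upper I a 0 - lower I a 0) * x a 0))) = M *m x + c0.
  rewrite [RHS]addrC /c0 /cycle_offset; apply/matrixP=> i j; rewrite !mxE.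
  rewrite !mulr_sumr -big_split; apply: eq_bigr => a _.
  by rewrite !mxE (ord1 j) /=; ring.
apply/seteqP; split=> z [x cx <-].
  exists (\col_a ((x a 0 - lower I a 0) / (upper I a 0 - lower I a 0))).
    move=> a; move: (cx a) (lu a) => cxa lua; rewrite mxE.
    rewrite ler_pdivrMr // mul1r divr_ge0 //=; lra.
  rewrite -img; congr (_ *: (_ *m _)).
  apply/matrixP=> a j; rewrite !mxE (ord1 j); field.
  by rewrite gt_eqF.
exists (\col_a (lower I a 0 + (upper I a 0 - lower I a 0) * x a 0)); last exact: img.
by move=> a; rewrite mxE; move: (cx a) (lu a); nra.
Qed.

Variable X : {set cube_label m}.
Hypothesis hX : fine_zonotopal_tiling I gam X.

(** Among the cells containing [cell I gam s], one that contains the most cells is maximal for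
    inclusion. *)
Lemma exists_tile s : s \in X ->
  exists2 t, is_tile I gam X t & cell I gam s `<=` cell I gam t.
Proof.
move=> Xs; pose below t := [set r in X | `[< cell I gam r `<=` cell I gam t >]]%SET.
pose P t := (t \in X) && `[< cell I gam s `<=` cell I gam t >].
have Ps : P s by rewrite /P Xs; apply/asboolP.
have [t /andP[Xt /asboolP st] tmax] := arg_maxnP (fun t => #|below t|) Ps.
exists t => //; split=> // t' Xt' tt'.
apply/seteqP; split=> //.
have Pt' : P t' by rewrite /P Xt'; apply/asboolP; apply: subset_trans st tt'.
have sub : below t \subset below t'.
  apply/fintype.subsetP => r; rewrite !inE => /andP[-> /asboolP rt] /=.
  by apply/asboolP; apply: subset_trans rt tt'.
have E : below t = below t' by apply/eqP; rewrite eqEcard sub; exact: tmax Pt'.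
have : t' \in below t by rewrite E !inE Xt'; apply/asboolP.
by rewrite inE => /andP[_ /asboolP].
Qed.

(** The strong tiling condition turns inclusion in a tile into inclusion of cube faces, so the free
    arcs of [s] are among the independent ones of a tile. *)
Lemma cell_free_independent s : s \in X -> cols_independent M (free_arcs s).
Proof.
move=> Xs; have [t tile_t st] := exists_tile Xs.
case: hX => -[_ _ strong] /(_ t tile_t)/cols_independentP; apply: cols_independentS.
have [Xt _] := tile_t.
by apply: (@cube_face_free R); rewrite (strong s t) // => x [].
Qed.

Let U : set 'cV[R]_m := faces_union X.

Lemma faces_union_surj z : unit_cube z -> exists2 x, U x & M *m x = M *m z.
Proof.
move=> cz; case: hX => -[[_ _ cov _ _] _ _] _.
have : cycle_offset_zonotope I gam (M *m z + c0).
  by rewrite cycle_offset_zonotope_image; exists z.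
rewrite -cov => -[_ [s Xs <-]]; rewrite cell_image => -[x sx /addIr Mx].
by exists x => //; exists s.
Qed.

Lemma cell_mem s x : cube_face s x -> cell I gam s (M *m x + c0).
Proof. by rewrite cell_image; exists x. Qed.

(** The two cells share a point, so they meet in a common face, which is the cell of some [r] in
    [X]. The strong condition puts [x] and [x'] into [cube_face r], where [M] is injective by
    independence. *)
Lemma faces_union_inj x x' : U x -> U x' -> M *m x = M *m x' -> x = x'.
Proof.
move=> [s Xs sx] [t Xt tx'] Mxx'; case: hX => -[[_ _ _ faces meet] _ strong] _.
have cs : cell I gam s (M *m x + c0) by exact: cell_mem.
have ct : cell I gam t (M *m x + c0) by rewrite Mxx'; exact: cell_mem.
have Ks : [set cell I gam s | s in [set` X]] (cell I gam s) by exists s.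
have Kt : [set cell I gam s | s in [set` X]] (cell I gam t) by exists t.
have [E0|[F _]] := meet _ _ Ks Kt.
  by have : set0 (M *m x + c0) by rewrite -E0.
have [r Xr rE] := faces _ _ Ks F.
have rs : cell I gam r `<=` cell I gam s by rewrite rE => z [].
have rt : cell I gam r `<=` cell I gam t by rewrite rE => z [].
have rx : cube_face r x by rewrite (strong r s) //; split=> //=; rewrite -/M -/c0 rE.
have rx' : cube_face r x'.
  by rewrite (strong r t) //; split=> //=; rewrite -/M -/c0 -Mxx' rE.
apply/eqP; rewrite -subr_eq0; apply/eqP; apply: (cell_free_independent Xr).
  exact: face_sub_free.
by rewrite mulmxBr Mxx' subrr.
Qed.

(* The face on which the arcs of free_arcs s outside J are fixed to 0
   maximizes a linear form dual to the generators. *)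
Lemma subface_mem s (J : {set 'I_m}) : s \in X -> J \subset free_arcs s ->
  exists2 r, r \in X & free_arcs r = J.
Proof.
move=> Xs Js; case: hX => -[[_ _ _ faces _] _ strong] _.
have [phi hphi] := cols_independent_dual
  (fun a => - (a \notin J)%:R) (cell_free_independent Xs).
pose s' : cube_label m :=
  [ffun a => if (s a == None) && (a \notin J) then Some false else s a].
have free_s' : free_arcs s' = J.
  apply/setP=> a; rewrite free_arcsE ffunE.
  have := fintype.subsetP Js a; rewrite free_arcsE.
  case: (a \in J) => [/(_ isT) sa|_]; first by rewrite andbF sa.
  by rewrite andbT; case: ifP.
pose F := [set x | cell I gam s x /\
   forall y, cell I gam s y -> (phi *m y) 0 0 <= (phi *m x) 0 0].
have [r Xr rE] : [set cell I gam s | s in [set` X]] F.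
  by apply: (faces (cell I gam s)); [exists s|exists phi].
exists r => //.
suff -> : r = s' by [].
apply: (@cube_face_inj R); rewrite (strong r s) //; last by rewrite rE => z [].
(* [phi] is 0 on the columns in [J] and -1 on those of the other free arcs, so it is maximal where
   the latter coordinates vanish. *)
have val x : cube_face s x -> (phi *m (M *m x + c0)) 0 0 =
    (phi *m (M *m face_point s 0 + c0)) 0 0 - \sum_(a in free_arcs s :\: J) x a 0.
  move=> sx; rewrite !mulmxDr !mulmxA [LHS]mxE [X in X - _]mxE.
  rewrite [RHS]addrAC; congr (_ + _); apply/eqP.
  rewrite eq_sym subr_eq addrC -subr_eq; apply/eqP.
  have -> : (phi *m M *m face_point s 0) 0 0 - (phi *m M *m x) 0 0 =
    - (phi *m M *m (x - face_point s 0)) 0 0 by rewrite mulmxBr !mxE; ring.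
  rewrite mxE -sumrN [RHS]big_mkcond; apply: eq_bigr => a _ /=.
  have Jw := face_point0_supported sx.
  rewrite inE; have [sa|sa] := boolP (a \in free_arcs s); last first.
    by rewrite Jw // mulr0 oppr0 andbF.
  rewrite hphi // !mxE; move: sa; rewrite free_arcsE => /eqP->; rewrite subr0 andbT.
  by case: (a \in J) => /=; ring.
apply/seteqP; split=> x.
  move=> [sx]; rewrite /= -/M -/c0 rE => -[_ maxx] a; rewrite ffunE.
  case: ifP => [/andP[/eqP sa Ja]|_]; last exact: sx.
  have s0 : cube_face s (face_point s (0 : R)) by apply: face_point_mem; lra.
  have := maxx _ (cell_mem s0); rewrite (val x sx) => h.
  have sge b : b \in (free_arcs s :\: J)%SET -> 0 <= x b 0.
    by rewrite inE free_arcsE => /andP[_ /eqP sb]; move: (sx b); rewrite sb => /andP[].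
  have /eqP : \sum_(b in free_arcs s :\: J) x b 0 = 0.
    by apply/eqP; rewrite eq_le sumr_ge0 // andbT; move: h; lra.
  rewrite psumr_eq0 // => /allP/(_ a (mem_index_enum _))/implyP.
  by rewrite inE Ja free_arcsE sa => /(_ isT)/eqP.
move=> s'x.
have sx : cube_face s x.
  move=> a; move: (s'x a); rewrite ffunE; case: ifP => // /andP[/eqP-> _] ->.
  by rewrite /= lexx ler01.
split=> //=; rewrite -/M -/c0 rE; split; first exact: cell_mem.
move=> z; rewrite cell_image => -[x' sx' <-]; rewrite (val x sx) (val x' sx').
rewrite [X in _ <= _ - X]big1 ?subr0 ?lerBlDr ?lerDl.
  apply: sumr_ge0 => a; rewrite inE free_arcsE => /andP[_ /eqP sa].
  by move: (sx' a); rewrite sa => /andP[].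
move=> a; rewrite inE free_arcsE => /andP[Ja sa].
by move: (s'x a); rewrite ffunE sa Ja.
Qed.

Lemma has_dim_cell s k : s \in X -> has_dim (cell I gam s) k <-> #|free_arcs s| = k.
Proof.
move=> Xs.
have D : has_dim (cell I gam s) #|free_arcs s|.
  by apply: has_dim_zonotope; apply/cols_independentP; exact: cell_free_independent.
by split=> [/(has_dim_unique D)//|<-].
Qed.

Lemma exists_cell (J : {set 'I_m}) : cols_independent M J ->
  exists2 s, s \in X & free_arcs s = J.
Proof.
move=> indJ.
have [] := @unique_sectionP _ _ _ M X faces_union_surj faces_union_inj J
  (const_mx 2^-1) indJ.
  by move=> a _; rewrite mxE; lra.
move=> _ /(_ 0)[|x [[s Xs sx] Jx _]]; first by move=> a; rewrite mxE lexx ler01.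
apply: (subface_mem Xs); apply/fintype.subsetP => a Ja; rewrite free_arcsE.
move: (sx a); rewrite Jx // mxE; case: (s a) => // e h.
by exfalso; move: h; case: e => /=; lra.
Qed.

Lemma full_cell_unique s t : s \in X -> t \in X -> free_arcs s = free_arcs t ->
  #|free_arcs s| = cyclomatic n m -> s = t.
Proof.
move=> Xs Xt st card_s.
have [] := @unique_sectionP _ _ _ M X faces_union_surj faces_union_inj
  (free_arcs s) (const_mx 2^-1) (cell_free_independent Xs).
  by move=> a _; rewrite mxE; lra.
move=> uniq _.
(* The centres of the two faces agree on the basis [free_arcs s], whose columns span everything. *)
have E : face_point s 2^-1 = face_point t 2^-1 :> 'cV[R]_m.
  apply: uniq.
  - by exists s => //; exact: face_midpoint_mem.
  - by exists t => //; exact: face_midpoint_mem.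
  - by move=> a; rewrite free_arcsE !mxE => /eqP->.
  - by move=> a; rewrite st free_arcsE !mxE => /eqP->.
  - exact: cols_independent_card_span (cell_free_independent Xs) card_s.
by apply: (@face_midpoint_inj R); [rewrite E|rewrite -E]; exact: face_midpoint_mem.
Qed.

Hypothesis hgam : integral_cycle_basis (graph I) gam.

Lemma scaled_cycle_matrixE (w : 'cV[R]_m) : M *m w = cycle_matrix R gam *m
  (\col_a ((upper I a 0 - lower I a 0) / (period I)%:R * w a 0)).
Proof.
apply/matrixP=> i j; rewrite !mxE; apply: eq_bigr => a _.
by rewrite !mxE (ord1 j); ring.
Qed.

Lemma cols_independent_spanning (S : {set 'I_m}) :
  cols_independent M (~: S)%SET <-> spanning_subgraph (graph I) S.
Proof.
rewrite spanning_subgraphP; split=> [ind|conn w Sw Mw].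
  move=> x y _ _; apply: contraT => nxy.
  pose W v := connect (linked (graph I) S [set: 'I_n]%SET) x v.
  (* The cut around the component [W] of [x] in [S], rescaled to lie in the kernel of [M]; no arc of
     [S] crosses it. *)
  pose w : 'cV[R]_m := \col_a (((upper I a 0 - lower I a 0) / (period I)%:R)^-1 *
    ((W (tgt (graph I) a))%:R - (W (src (graph I) a))%:R)).
  have csym := sym_connect_sym (@linked_sym _ _ (graph I) S).
  have w0 : w = 0.
    apply: ind => [a|].
      rewrite inE negbK mxE => /(linked_arc (graph I)) /connect1 /(same_connect_r csym) E.
      by rewrite /W E subrr mulr0.
    rewrite scaled_cycle_matrixE -(cycle_matrix_cut R hgam W).
    congr (_ *m _); apply/matrixP=> a j; rewrite !mxE mulVKf //.
    by rewrite gt_eqF // scale_gt0.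
  case: hI => _ _ [_ conn _] _ _.
  (* [w = 0] says that no arc of the whole graph crosses the cut, against connectivity. *)
  have Wcl : fingraph.closed (linked (graph I) [set: 'I_m]%SET [set: 'I_n]%SET) W.
    apply: intro_closed; first exact/sym_connect_sym/linked_sym.
    move=> u v; rewrite linked_setT => /existsP[a /andP[_ uv]] Wu.
    have /matrixP/(_ a 0) := w0; rewrite !mxE => /eqP.
    rewrite mulf_eq0 invr_eq0 gt_eqF ?scale_gt0 //= subr_eq0 eqr_nat.
    have [Ws|Ws] := boolP (W (src (graph I) a));
      have [Wt|Wt] := boolP (W (tgt (graph I) a)) => // _.
      by case/orP: uv => /andP[/eqP us /eqP tv]; rewrite -?us -?tv.
    by case/orP: uv => /andP[/eqP us /eqP tv]; move: Wu;
      rewrite /in_mem /= -?us -?tv (negPf Ws, negPf Wt).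
  have := closed_connect Wcl (conn x y (finset.in_setT _) (finset.in_setT _)).
  by rewrite /in_mem /= /W connect0 (negPf nxy).
rewrite scaled_cycle_matrixE in Mw.
apply/matrixP => a j; rewrite (ord1 j) [RHS]mxE.
have [Sa|Sa] := boolP (a \in S); first by rewrite Sw // inE Sa.
(* The fundamental cycle of [a] meets the support of [w] at most in [a]. *)
have [g [cg ga gS]] := fundamental_cycle conn Sa.
have := oriented_cycle_orthogonal hgam cg Mw.
rewrite (bigD1 a) //= big1 ?addr0 => [|b ba].
  rewrite ga mul1r mxE => /eqP; rewrite mulf_eq0 gt_eqF ?scale_gt0 //=.
  by move=> /eqP.
have [Sb|Sb] := boolP (b \in S); first by rewrite mxE Sw ?mulr0 // inE Sb.
have [->|/(gS b ba)] := eqVneq (g b 0) 0; first by rewrite mul0r.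
by rewrite (negPf Sb).
Qed.

Lemma spanning_subgraph_cell k S : spanning_subgraphs (graph I) (m - k)%N S ->
  exists2 s, s \in cells_of_dim I gam X k & fixed_arcs s = S.
Proof.
move=> [span_S card_S].
have [s Xs sS] := exists_cell ((cols_independent_spanning S).2 span_S).
exists s; last by rewrite -[LHS]finset.setCK -[LHS]/(~: free_arcs s)%SET sS finset.setCK.
rewrite inE Xs; apply/asboolP/(has_dim_cell _ Xs).
(* For [k > m] the truncated difference is 0, so [S] would be empty and could not connect more than
   one vertex. *)
have km : (k <= m)%N.
  rewrite leqNgt; apply/negP => mk; have := (spanning_subgraphP _ _).1 span_S.
  have -> : S = finset.set0.
    by apply/eqP; rewrite -cards_eq0 card_S subn_eq0 ltnW.
  by case: hI => _ _ [/ltnW n1 _ _] _ _; exact: no_arcs_disconnected.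
by rewrite sS cardsCs finset.setCK card_S card_ord subKn.
Qed.

Lemma cell_spanning_subgraph k s : s \in cells_of_dim I gam X k ->
  spanning_subgraphs (graph I) (m - k)%N (fixed_arcs s).
Proof.
rewrite inE => /andP[Xs /asboolP/(has_dim_cell _ Xs) card_s].
split; first by apply/cols_independent_spanning; exact: cell_free_independent.
have : (#|fixed_arcs s| + #|free_arcs s| = m)%N by rewrite cardsC card_ord.
by rewrite card_s => /(congr1 (subn^~ k)); rewrite addnK.
Qed.

Lemma cell_translate s :
  is_translate (cell I gam s) (zonotope (scaled_cycle_submatrix I gam (fixed_arcs s)) 0).
Proof.
exists (cell_offset I gam s); apply/seteqP; split=> x.
  move=> [v cv <-]; exists (scaled_cycle_submatrix I gam (fixed_arcs s) *m v) => //.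
  by exists v => //; rewrite addr0.
by move=> [_ [v cv <-] <-]; exists v => //; rewrite addr0.
Qed.

End Tiling.

(** * The correspondence between spanning subgraphs and cells *)

Unset Implicit Arguments.

Theorem lemma4p2 (R : realType) (n m : nat) (I : pesp R n m)
    (hI : pesp_instance I)
    (gam : 'I_(cyclomatic n m) -> 'cV[int]_m)
    (hgam : integral_cycle_basis (graph I) gam)
    (X : {set cube_label m}) (hX : fine_zonotopal_tiling I gam X) (k : nat) :
  (exists f : {set 'I_m} -> {set cube_label m},
    set_bij (spanning_subgraphs (graph I) (m - k)%N)
            [set` parallel_classes I gam X k] f /\
    forall S, spanning_subgraphs (graph I) (m - k)%N S ->
      forall s, s \in f S ->
        is_translate (cell I gam s)
          (zonotope (scaled_cycle_submatrix I gam S) 0)) /\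
  (k = cyclomatic n m ->
   exists f : {set 'I_m} -> cube_label m,
    set_bij (spanning_subgraphs (graph I) (m - k)%N)
            [set` cells_of_dim I gam X k] f /\
    forall S, spanning_subgraphs (graph I) (m - k)%N S ->
      is_translate (cell I gam (f S))
        (zonotope (scaled_cycle_submatrix I gam S) 0)).
Proof.
split.
  (* The image is a whole parallel class, so no cell is chosen; [spanning_subgraph_cell] makes it
     nonempty, which gives injectivity. *)
  exists (fun S => [set s in cells_of_dim I gam X k | S == fixed_arcs s]%SET).
  split=> [|S _ s]; last by rewrite inE => /andP[_ /eqP->]; exact: cell_translate.
  split=> [S hS|S S' /set_mem hS /set_mem hS' E|C].
  - have [s Ks <-] := spanning_subgraph_cell hI hX hgam hS.
    by apply/imsetP; exists s.
  - have [s Ks sS] := spanning_subgraph_cell hI hX hgam hS.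
    have : s \in [set s in cells_of_dim I gam X k | S == fixed_arcs s]%SET.
      by rewrite inE Ks sS eqxx.
    by rewrite E inE => /andP[_ /eqP->].
  - move=> /imsetP[s Ks ->]; exists (fixed_arcs s) => //.
    exact: (cell_spanning_subgraph hI hX hgam Ks).
move=> kmu.
(* The default label is never reached on the spanning subgraphs considered, where [pick]
   succeeds. *)
pose f (S : {set 'I_m}) : cube_label m :=
  odflt [ffun=> None] [pick s in cells_of_dim I gam X k | fixed_arcs s == S].
have fP S : spanning_subgraphs (graph I) (m - k)%N S ->
    f S \in cells_of_dim I gam X k /\ fixed_arcs (f S) = S.
  move=> /(spanning_subgraph_cell hI hX hgam)[s Ks sS]; rewrite /f.
  case: pickP => [t /andP[Kt /eqP]//|/(_ s)].
  by rewrite Ks sS eqxx.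
exists f; split=> [|S /fP[_ fS]]; last by have := cell_translate I gam (f S); rewrite fS.
split=> [S /fP[]//|S S' /set_mem/fP[_ fS] /set_mem/fP[_ fS'] E|s Ks].
  by rewrite -fS E fS'.
have hs := cell_spanning_subgraph hI hX hgam Ks.
exists (fixed_arcs s) => //; have [Kf fE] := fP _ hs.
have Ks' : s \in cells_of_dim I gam X k := Ks.
move: Kf Ks'; rewrite !inE => /andP[Xf /asboolP/(has_dim_cell hX _ Xf) card_f] /andP[Xs _].
(* Surjectivity: in full dimension a cell is determined by its fixed arcs. *)
by apply: (full_cell_unique hI hX Xf Xs);
  [rewrite /free_arcs fE|exact: etrans card_f kmu].
Qed.
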